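(* Let $(\mathfrak a,\mathscr B_{\mathfrak a},\omega_{\mathfrak a})$ be an even NIS-Lie superalgebra over a field $\mathbb K$ of characteristic $2$ equipped with a closed $\bar 1$-antisymmetric ortho-orthogonal form $\omega_{\mathfrak a}$, and let $\tilde\Delta\in\mathfrak{der}(\mathfrak a)_{\bar 0}$ be the unique invertible derivation such that $\omega_{\mathfrak a}(\cdot,\cdot)=\mathscr B_{\mathfrak a}(\tilde\Delta(\cdot),\cdot)$. Let $(\mathfrak g,\mathscr B_{\mathfrak g})$, $\mathfrak g=\mathbb Kx\oplus\mathfrak a\oplus\mathbb Kx^*$, be the $\mathscr D_{\bar 1}$-extension of $(\mathfrak a,\mathscr B_{\mathfrak a})$ by means of a derivation $\mathscr D\in\mathfrak{der}(\mathfrak a)_{\bar 1}$ and $a_0\in\mathfrak a_{\bar 0}$ satisfying $\mathscr B_{\mathfrak a}(\mathscr D(a),b)=\mathscr B_{\mathfrak a}(a,\mathscr D(b))$ for all $a,b\in\mathfrak a$, $\mathscr D^2=\mathrm{ad}_{a_0}$ and $\mathscr D(a_0)=0$. Suppose there exist $\lambda\in\mathbb K\setminus\{0\}$ and $b_0\in\mathfrak a_{\bar 1}$ such that $$[\tilde\Delta,\mathscr D]=\lambda\mathscr D+\mathrm{ad}_{b_0},\qquad \tilde\Delta(a_0)=\mathscr D(b_0).$$ Then the linear map $\Delta:\mathfrak g\to\mathfrak g$ defined, for arbitrary $\mu\in\mathbb K$, by $$\Delta(x)=\lambda x,\qquad \Delta(x^* )=\lambda x^*+b_0+\mu x,\qquad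 \Delta(a)=\tilde\Delta(a)+\mathscr B_{\mathfrak a}(a,b_0)x\quad(a\in\mathfrak a)$$ is an invertible derivation of $\mathfrak g$ such that $\mathscr B_{\mathfrak g}$ is $\Delta$-invariant. Consequently, $(\mathfrak g,\mathscr B_{\mathfrak g},\omega_{\mathfrak g})$ is a NIS-Lie superalgebra with a closed $\bar 1$-antisymmetric ortho-orthogonal form $\omega_{\mathfrak g}:=\mathscr B_{\mathfrak g}(\Delta(\cdot),\cdot)$.
   Context: All spaces are finite-dimensional. A Lie superalgebra in characteristic $2$ is a superspace $\mathfrak g=\mathfrak g_{\bar 0}\oplus\mathfrak g_{\bar 1}$ such that $\mathfrak g_{\bar 0}$ is a Lie algebra, $\mathfrak g_{\bar 1}$ is a $\mathfrak g_{\bar 0}$-module made two-sided by symmetry, together with a squaring $s_{\mathfrak g}:\mathfrak g_{\bar 1}\to\mathfrak g_{\bar 0}$ with $s_{\mathfrak g}(\lambda x)=\lambda^2 s_{\mathfrak g}(x)$ such that $[x,y]_{\mathfrak g}:=s_{\mathfrak g}(x+y)-s_{\mathfrak g}(x)-s_{\mathfrak g}(y)$ is bilinear on $\mathfrak g_{\bar 1}$, and $[s_{\mathfrak g}(x),y]_{\mathfrak g}=[x,[x,y]_{\mathfrak g}]_{\mathfrak g}$ for $x\in\mathfrak g_{\bar 1}$, $y\in\mathfrak g$. A derivation is a linear map $D$ with $D([x,y])=[D(x),y]+[x,D(y)]$ for $x\in\mathfrak g_{\bar 0},y\in\mathfrak g$ and $D(s_{\mathfrak g}(x))=[D(x),x]$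 for $x\in\mathfrak g_{\bar 1}$; $\mathfrak{der}(\mathfrak g)_{\bar 0}$, $\mathfrak{der}(\mathfrak g)_{\bar 1}$ denote the even and odd ones. $[\tilde\Delta,\mathscr D]=\tilde\Delta\mathscr D+\mathscr D\tilde\Delta$. NIS: a non-degenerate invariant ($\mathscr B([x,y],z)=\mathscr B(x,[y,z])$) symmetric bilinear form with $\mathscr B(x,x)=0$ for odd $x$. A form is $\bar 1$-antisymmetric if symmetric with $\omega(x,x)=0$ for all even $x$; ortho-orthogonal means even and non-degenerate; closed means $\omega([x,y],z)+\omega([z,x],y)+\omega([y,z],x)=0$ for all $x,y,z$ and $\omega(s_{\mathfrak g}(x),z)=\omega(x,[x,z])$ for $x\in\mathfrak g_{\bar 1},z\in\mathfrak g$. $\mathscr B$ is $\Delta$-invariant if $\mathscr B(\Delta(u),v)=\mathscr B(u,\Delta(v))$ for all $u,v$ and $\mathscr B(\Delta(u),u)=0$ for all even $u$. $\mathscr D_{\bar 1}$-extension: for $\mathscr D,a_0$ as in the claim, $\mathfrak g=\mathbb Kx\oplus\mathfrak a\oplus\mathbb Kx^*$ with $x,x^*$ odd, squaring $s_{\mathfrak g}(rx+a+tx^* )=s_{\mathfrak a}(a)+t^2a_0+t\mathscr D(a)$ ($a\in\mathfrak a_{\bar 1}$, $r,t\in\mathbb K$), bracket $[x,\mathfrak g]_{\mathfrak g}=0$, $[a,b]_{\mathfrak g}=[a,b]_{\mathfrak a}+\mathscr B_{\mathfrak a}(\mathscr D(a),b)x$, $[x^*,a]_{\mathfrak g}=\mathscr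 D(a)$ ($a,b\in\mathfrak a$), and form $\mathscr B_{\mathfrak g}|_{\mathfrak a\times\mathfrak a}=\mathscr B_{\mathfrak a}$, $\mathscr B_{\mathfrak g}(\mathfrak a,x)=\mathscr B_{\mathfrak g}(\mathfrak a,x^* )=0$, $\mathscr B_{\mathfrak g}(x,x^* )=1$, $\mathscr B_{\mathfrak g}(x,x)=\mathscr B_{\mathfrak g}(x^*,x^* )=0$; this is an even NIS-Lie superalgebra. *)

(* Defs.v *)
From mathcomp Require Import all_boot all_order all_algebra.

Set Implicit Arguments.
Unset Strict Implicit.
Unset Printing Implicit Defensive.

Import GRing.Theory.
Local Open Scope ring_scope.

(* Parities are booleans: false is even, true is odd, and the sum of two
   parities is (+).  The squaring is a total function on the carrier, but only
   its values on the odd part are ever constrained or used. *)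
Record superdata (K : fieldType) := SuperData {
  sd_carrier :> vectType K;
  sd_part : bool -> {vspace sd_carrier};
  sd_br : sd_carrier -> sd_carrier -> sd_carrier;
  sd_sq : sd_carrier -> sd_carrier
}.

Arguments SuperData {K}.

Notation even_part g := (sd_part g false).
Notation odd_part g := (sd_part g true).

Definition is_superspace (K : fieldType) (g : superdata K) : Prop :=
  (even_part g + odd_part g = fullv)%VS /\
  (even_part g :&: odd_part g = 0)%VS.

(* lsa_jacobi is the Jacobi identity of g_0 when z is even and the module axiom
   of g_1 when z is odd. *)
Record is_lie_superalgebra2 (K : fieldType) (g : superdata K) : Prop := {
  lsa_superspace : is_superspace g;
  lsa_bilinear : bilinear_for *:%R *:%R (@sd_br K g);
  lsa_graded : forall (i j : bool) (x y : g),
    x \in sd_part g i -> y \in sd_part g j ->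
    sd_br x y \in sd_part g (i (+) j);
  lsa_alternating : forall x : g, x \in even_part g -> sd_br x x = 0;
  lsa_jacobi : forall x y z : g, x \in even_part g -> y \in even_part g ->
    sd_br (sd_br x y) z = sd_br x (sd_br y z) - sd_br y (sd_br x z);
  lsa_two_sided : forall x y : g, x \in even_part g -> y \in odd_part g ->
    sd_br y x = sd_br x y;
  lsa_sq_even : forall x : g, x \in odd_part g -> sd_sq x \in even_part g;
  lsa_sq_scale : forall (c : K) (x : g), x \in odd_part g ->
    sd_sq (c *: x) = c ^+ 2 *: sd_sq x;
  lsa_polarization : forall x y : g, x \in odd_part g -> y \in odd_part g ->
    sd_br x y = sd_sq (x + y) - sd_sq x - sd_sq y;
  lsa_sq_jacobi : forall x y : g, x \in odd_part g ->
    sd_br (sd_sq x) y = sd_br x (sd_br x y)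
}.

Section Derivations.
Variables (K : fieldType) (g : superdata K).

Definition is_derivation (D : g -> g) : Prop :=
  [/\ linear D,
      forall x y : g, x \in even_part g ->
        D (sd_br x y) = sd_br (D x) y + sd_br x (D y) &
      forall x : g, x \in odd_part g -> D (sd_sq x) = sd_br (D x) x].

Definition has_parity (i : bool) (D : g -> g) : Prop :=
  forall (j : bool) (x : g), x \in sd_part g j -> D x \in sd_part g (i (+) j).

(* D \in der(g)_i *)
Definition in_der (i : bool) (D : g -> g) : Prop :=
  is_derivation D /\ has_parity i D.

End Derivations.

Section Forms.
Variables (K : fieldType) (g : superdata K).
Implicit Types B w : g -> g -> K.

Definition symmetric_form B : Prop := forall x y : g, B x y = B y x.

Definition nondegenerate_form B : Prop :=
  forall x : g, (forall y : g, B x y = 0) -> x = 0.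

Definition even_form B : Prop :=
  forall (i j : bool) (x y : g), x \in sd_part g i -> y \in sd_part g j ->
    i != j -> B x y = 0.

Definition invariant_form B : Prop :=
  forall x y z : g, B (sd_br x y) z = B x (sd_br y z).

Record is_NIS B : Prop := {
  nis_bilinear : bilinear_for *%R *%R B;
  nis_symmetric : symmetric_form B;
  nis_odd_null : forall x : g, x \in odd_part g -> B x x = 0;
  nis_invariant : invariant_form B;
  nis_nondegenerate : nondegenerate_form B
}.

Definition odd_antisymmetric_form w : Prop :=
  symmetric_form w /\ (forall x : g, x \in even_part g -> w x x = 0).

Definition ortho_orthogonal_form w : Prop :=
  even_form w /\ nondegenerate_form w.

Definition closed_form w : Prop :=
  (forall x y z : g,
     w (sd_br x y) z + w (sd_br z x) y + w (sd_br y z) x = 0) /\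
  (forall x z : g, x \in odd_part g -> w (sd_sq x) z = w x (sd_br x z)).

Definition form_invariant_under B (D : g -> g) : Prop :=
  (forall u v : g, B (D u) v = B u (D v)) /\
  (forall u : g, u \in even_part g -> B (D u) u = 0).

End Forms.

Record is_even_NIS_lie_superalgebra2 (K : fieldType) (g : superdata K)
    (B : g -> g -> K) : Prop := {
  enis_lie : is_lie_superalgebra2 g;
  enis_NIS : is_NIS B;
  enis_even : even_form B
}.

Record is_closed_antisym_ortho_form (K : fieldType) (g : superdata K)
    (w : g -> g -> K) : Prop := {
  cao_bilinear : bilinear_for *%R *%R w;
  cao_closed : closed_form w;
  cao_antisymmetric : odd_antisymmetric_form w;
  cao_ortho : ortho_orthogonal_form w
}.

(* The triple (r, a, t) stands for r x + a + t x^*. *)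
Section OddExtension.
Variables (K : fieldType) (g : superdata K) (B : g -> g -> K).
Variables (D : g -> g) (a0 : g).

Definition ext_carrier : vectType K := (K^o * g * K^o)%type.

Definition ext_vec (r : K) (a : g) (t : K) : ext_carrier := (r, a, t).

Definition ext_x : ext_carrier := ext_vec 1 0 0.
Definition ext_xs : ext_carrier := ext_vec 0 0 1.
Definition ext_inj (a : g) : ext_carrier := ext_vec 0 a 0.

Definition ext_part (i : bool) : {vspace ext_carrier} :=
  (linfun ext_inj @: sd_part g i +
     (if i then <[ext_x]> + <[ext_xs]> else 0))%VS.

(* Bilinear extension of the brackets on a and of [x^*, a] = D(a); moreover
   [a, x^*] = D(a) by symmetry and [x^*, x^*] = 0 by polarization. *)
Definition ext_br (u v : ext_carrier) : ext_carrier :=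
  let: (_, a, t) := u in let: (_, b, t') := v in
  ext_vec (B (D a) b) (sd_br a b + t *: D b + t' *: D a) 0.

Definition ext_sq (u : ext_carrier) : ext_carrier :=
  let: (_, a, t) := u in
  ext_inj (sd_sq a + t ^+ 2 *: a0 + t *: D a).

Definition odd_extension : superdata K :=
  SuperData ext_carrier ext_part ext_br ext_sq.

Definition ext_form (u v : odd_extension) : K :=
  let: (r, a, t) := u in let: (r', b, t') := v in
  B a b + r * t' + t * r'.

(* The linear map with ext_x |-> lam x, a |-> Dt a + B a b0 x and
   ext_xs |-> lam x^* + b0 + mu x. *)
Definition ext_Delta (Dt : g -> g) (lam mu : K) (b0 : g)
    (u : odd_extension) : odd_extension :=
  let: (r, a, t) := u in
  r *: (lam *: ext_x)
  + (ext_inj (Dt a) + B a b0 *: ext_x)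
  + t *: (lam *: ext_xs + ext_inj b0 + mu *: ext_x).

End OddExtension.

(* Main.v *)
Require Import Defs.
From HB Require Import structures.
From mathcomp Require Import all_boot all_order all_algebra.
From mathcomp Require Import ring.
Import GRing.Theory.
Local Open Scope ring_scope.

Set Implicit Arguments.
Unset Strict Implicit.

(** Write [B] for the form on [a], [Bg] for its extension to [g], and [Dt] for
the given even derivation of [a].  The proof separates what is specific to the
double extension from a principle valid on every even NIS-Lie superalgebra: if
an injective even derivation [Delta] leaves the form invariant, then
[w u v = Bg (Delta u) v] is a closed antisymmetric ortho-orthogonal form
([derived_form_closed_antisym_ortho]).  Indeed, moving [Delta] across [Bg] and
using invariance, the cyclic sum in the closedness condition becomes
[Bg z (Delta [x, y] + [Delta x, y] + [x, Delta y])], which vanishes because the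
characteristic is 2, and the squaring condition is [Delta (s x) = [Delta x, x]]
paired with [z].  Non-degeneracy of [w] is that of [Bg] and injectivity.

It remains to see that [g] is an even NIS-Lie superalgebra
([odd_extension_NIS]) and that [Delta] has these properties.  Both are
componentwise.  In the [a]-component, the axioms of [g] reduce to the Leibniz
rule for [D], to [D^2 = ad a0] and to [D a0 = 0]; in the [x]-component they
reduce to parity and to invariance of [B] and self-adjointness of [D], the one
extra input being [B (D u) (D u) = 0] for odd [u], which comes from
[B u [a0, u] = B [u, u] a0] and [[u, u] = 0].

For [Delta], self-adjointness and isotropy of [Dt] on even vectors are the
symmetry and antisymmetry of the form [B (Dt u) v].  The identity
[Dt D + D Dt = lam D + ad b0] accounts for the terms by which [Delta] fails to
commute with [ad x^*], in the [a]-component directly and in the [x]-component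
after pairing with [B]; [Dt a0 = D b0] is the derivation rule on the
square [a0] of [x^*].  Finally [Delta] is block triangular with diagonal blocks
[lam], [Dt], [lam], hence invertible. *)

(** * Vector spaces in characteristic 2 and bilinear maps *)

Section CharTwo.
Variables (K : fieldType) (charK : 2%N \in [pchar K]) (V : lmodType K).

Lemma addvv_pchar2 (v : V) : v + v = 0.
Proof. by rewrite -mulr2n -scaler_nat (pcharf0 charK) scale0r. Qed.

Lemma oppv_pchar2 (v : V) : - v = v.
Proof. by apply/eqP; rewrite eq_sym -addr_eq0 addvv_pchar2. Qed.

End CharTwo.

(** Bilinearity occurs below as a hypothesis on plain functions; these lemmas
give its rewriting rules without registering a structure for each map. *)
Section BilinearRules.
Variables (R : nzRingType) (U U' : lmodType R) (V : zmodType).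
Variables (s s' : GRing.Scale.law R V) (f : U -> U' -> V).
Hypothesis fb : bilinear_for s s' f.

Let F : {bilinear U -> U' -> V | s & s'} :=
  HB.pack f (bilinear_isBilinear.Build R U U' V s s' f fb).

Lemma bilinear_forDl u v w : f (u + v) w = f u w + f v w.
Proof. exact: (linearDl F w u v). Qed.

Lemma bilinear_forDr u v w : f u (v + w) = f u v + f u w.
Proof. exact: (linearDr F u v w). Qed.

Lemma bilinear_forZl c u v : f (c *: u) v = s c (f u v).
Proof. exact: (linearZl_LR F v c u). Qed.

Lemma bilinear_forZr c u v : f u (c *: v) = s' c (f u v).
Proof. exact: (linearZr_LR F u c v). Qed.

Lemma bilinear_for0r u : f u 0 = 0.
Proof. exact: (linear0r F u). Qed.

End BilinearRules.

(** * Lie superalgebras in characteristic 2 *)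

Section LieSuperalgebra.
Variables (K : fieldType) (charK : 2%N \in [pchar K]) (g : superdata K).
Hypothesis gL : is_lie_superalgebra2 g.

Let brDl := bilinear_forDl (lsa_bilinear gL).
Let brDr := bilinear_forDr (lsa_bilinear gL).

Let vv := @addvv_pchar2 K charK g.
Let Nv := @oppv_pchar2 K charK g.

Lemma superspace_decomp (x : g) :
  exists2 x0, x0 \in even_part g & exists2 x1, x1 \in odd_part g & x = x0 + x1.
Proof.
by apply/memv_addP; case: (lsa_superspace gL) => -> _; rewrite memvf.
Qed.

(** The three homogeneous cases have three different causes: polarizing
[[x, x] = 0] on the even part, polarization of the squaring on the odd part,
and two-sidedness of the module in the mixed case. *)
Lemma sd_brC (x y : g) : sd_br x y = sd_br y x.
Proof.
have ev u v : u \in even_part g -> v \in even_part g -> sd_br u v = sd_br v u.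
  move=> ue ve; have := lsa_alternating gL (rpredD ue ve).
  rewrite brDl !brDr /= (lsa_alternating gL ue).
  rewrite (lsa_alternating gL ve) addr0 add0r => /eqP.
  by rewrite addr_eq0 Nv => /eqP.
have od u v : u \in odd_part g -> v \in odd_part g -> sd_br u v = sd_br v u.
  move=> uo vo; rewrite (lsa_polarization gL uo vo) (lsa_polarization gL vo uo).
  by rewrite [v + u]addrC addrAC.
have [x0 x0e [x1 x1o ->]] := superspace_decomp x.
have [y0 y0e [y1 y1o ->]] := superspace_decomp y.
rewrite !brDl !brDr /= (ev _ _ x0e y0e) (od _ _ x1o y1o).
by rewrite (lsa_two_sided gL y0e x1o) (lsa_two_sided gL x0e y1o) addrACA.
Qed.

Lemma sd_br_odd_self (x : g) : x \in odd_part g -> sd_br x x = 0.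
Proof.
move=> xo; rewrite (lsa_polarization gL xo xo) vv -addrA -opprD vv oppr0 addr0.
have := lsa_sq_scale gL 0 xo.
by rewrite scale0r expr0n scale0r.
Qed.

(** A derivation is only required to respect brackets with an even left entry;
for two odd entries the Leibniz rule is the polarization of the rule on
squares. *)
Lemma derivation_br (D : g -> g) (x y : g) : is_derivation D ->
  D (sd_br x y) = sd_br (D x) y + sd_br x (D y).
Proof.
case=> Dlin Dbr Dsq.
pose DL : {linear g -> g} := HB.pack D (GRing.isLinear.Build K g g _ D Dlin).
have DD u v : D (u + v) = D u + D v := linearD DL u v.
have od u v : u \in odd_part g -> v \in odd_part g ->
    D (sd_br u v) = sd_br (D u) v + sd_br u (D v).
  move=> uo vo; rewrite (lsa_polarization gL uo vo) !Nv !DD.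
  rewrite !Dsq ?rpredD // DD brDl !brDr /= [sd_br (D v) u]sd_brC.
  (* Only the mixed terms of [D (u + v), u + v] survive. *)
  by rewrite [LHS](AC (2*2*1*1) ((2*3)*((1*5)*(4*6)))) /= !vv !addr0.
have [x0 x0e [x1 x1o ->]] := superspace_decomp x.
have [y0 y0e [y1 y1o ->]] := superspace_decomp y.
rewrite brDl /= [LHS]DD Dbr // ![D (_ + _)]DD !brDl !brDr /= !DD.
rewrite (od _ _ x1o y1o) (sd_brC x1 y0) (Dbr y0) //.
rewrite (sd_brC (D y0)) (sd_brC y0 (D x1)) [sd_br x1 (D y0) + _]addrC.
by rewrite [RHS]addrACA; congr (_ + _); rewrite addrACA.
Qed.

(** The general principle behind the form on the extension: closedness is the
derivation property of [D] read through the invariant form. *)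
Lemma derived_form_closed_antisym_ortho (B : g -> g -> K) (D : g -> g) :
  is_NIS B -> even_form B -> in_der false D -> injective D ->
  form_invariant_under B D ->
  is_closed_antisym_ortho_form (fun u v => B (D u) v).
Proof.
move=> [Bbil Bsym Bodd Binv Bnd] Bev [Dder Dpar] Dinj [BD BD0].
have [Dlin Dbr Dsq] := Dder.
pose DL : {linear g -> g} := HB.pack D (GRing.isLinear.Build K g g _ D Dlin).
have Bl := bilinear_forDr Bbil.
split.
- split=> [v | u] c x y; last exact: Bbil.2.
  by rewrite Dlin; apply: Bbil.1.
- split=> [x y z | x z xo]; last by rewrite Dsq // Binv.
  (* All three terms are brought to the shape B z _. *)
  rewrite [B (D (sd_br x y)) z]Bsym (sd_brC y z) !BD !Binv -!Bl.
  rewrite (derivation_br (D := D)) // [sd_br (D x) y]sd_brC.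
  rewrite [X in B z X](AC (2*1*1) ((1*4)*(2*3))) /= !vv.
  exact: (bilinear_for0r Bbil).
- split=> // x y; by rewrite BD Bsym.
- split.
    move=> i j x y xi yj nij; apply: Bev yj nij; exact: Dpar xi.
  move=> x Bx; apply: Dinj; rewrite [D 0](linear0 DL); exact: Bnd.
Qed.

End LieSuperalgebra.

(** * The double extension by an odd derivation *)

Section OddExtension.
Variables (K : fieldType) (charK : 2%N \in [pchar K]) (a : superdata K).
Variables (B : a -> a -> K) (aN : is_even_NIS_lie_superalgebra2 B).
Variables (D : a -> a) (D_der : in_der true D).
Variables (a0 : a) (a0_even : a0 \in even_part a).
Hypothesis D_B : forall u v : a, B (D u) v = B u (D v).
Hypothesis D_square : forall u : a, D (D u) = sd_br a0 u.
Hypothesis D_a0 : D a0 = 0.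

Let aL := enis_lie aN.
Let Bsym := nis_symmetric (enis_NIS aN).
Let Binv := nis_invariant (enis_NIS aN).
Let Bev := enis_even aN.
Let brC := sd_brC charK aL.
Let vv := @addvv_pchar2 K charK a.
Let Nv := @oppv_pchar2 K charK a.
Let D_br u v : D (sd_br u v) = sd_br (D u) v + sd_br u (D v) :=
  derivation_br charK aL u v D_der.1.
Let D_sq u : u \in odd_part a -> D (sd_sq u) = sd_br (D u) u.
Proof. by case: D_der => -[_ _ +] _; apply. Qed.

Let brDl := bilinear_forDl (lsa_bilinear aL).
Let brDr := bilinear_forDr (lsa_bilinear aL).
Let brZl c u v : sd_br (c *: u) v = c *: sd_br u v :=
  bilinear_forZl (lsa_bilinear aL) c u v.
Let brZr c u v : sd_br u (c *: v) = c *: sd_br u v :=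
  bilinear_forZr (lsa_bilinear aL) c u v.
Let BDl := bilinear_forDl (nis_bilinear (enis_NIS aN)).
Let BDr := bilinear_forDr (nis_bilinear (enis_NIS aN)).
Let BZl c u v : B (c *: u) v = c * B u v :=
  bilinear_forZl (nis_bilinear (enis_NIS aN)) c u v.
Let BZr c u v : B u (c *: v) = c * B u v :=
  bilinear_forZr (nis_bilinear (enis_NIS aN)) c u v.
Let D_linear : linear D. Proof. by case: D_der => -[]. Qed.
Let DL : {linear a -> a} := HB.pack D (GRing.isLinear.Build K a a _ D D_linear).
Let DD u v : D (u + v) = D u + D v := linearD DL u v.
Let DZ c u : D (c *: u) = c *: D u := linearZ_LR DL c u.

Let g := odd_extension B D a0.
Let Bg : g -> g -> K := @ext_form K a B D a0.
(* Typing the triples in g itself makes the bracket, the squaring and the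
   linear operations of g rewritable on them. *)
Let vec r u t : g := ext_vec r u t.

Let vecD r u t r' v t' :
  vec r u t + vec r' v t' = vec (r + r') (u + v) (t + t').
Proof. by []. Qed.
Let vecZ c r u t : c *: vec r u t = vec (c * r) (c *: u) (c * t).
Proof. by []. Qed.
Let brE r u t r' v t' : sd_br (vec r u t) (vec r' v t') =
  vec (B (D u) v) (sd_br u v + t *: D v + t' *: D u) 0.
Proof. by []. Qed.
Let sqE r u t :
  sd_sq (vec r u t) = vec 0 (sd_sq u + t ^+ 2 *: a0 + t *: D u) 0.
Proof. by []. Qed.
Let formE r u t r' v t' :
  Bg (vec r u t) (vec r' v t') = B u v + r * t' + t * r'.
Proof. by []. Qed.

Lemma odd_extension_vecP (z : g) : exists r u t, z = vec r u t.
Proof. by case: z => [[r u] t]; exists r, u, t. Qed.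

Lemma odd_extension_span r t :
  r *: ext_x a + t *: ext_xs a = vec r 0 t.
Proof.
rewrite -[LHS]/(r *: vec 1 0 0 + t *: vec 0 0 1) !vecZ vecD.
by rewrite !mulr0 !mulr1 !scaler0 !addr0 add0r.
Qed.

Lemma mem_odd_extension i r u t :
  (vec r u t \in sd_part g i) =
  (u \in sd_part a i) && (i || (r == 0) && (t == 0)).
Proof.
have inj_lin : linear (@ext_inj K a).
  by move=> c x y; rewrite -[RHS]/(c *: vec 0 x 0 + vec 0 y 0) vecZ vecD mulr0 addr0.
pose f : {linear a -> ext_carrier a} :=
  HB.pack (@ext_inj K a) (GRing.isLinear.Build K a (ext_carrier a) _ _ inj_lin).
have fE x : linfun (@ext_inj K a) x = vec 0 x 0 by exact: (lfunE f x).
apply/memv_addP/andP.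
  move=> [_ /memv_imgP [x xi ->] [w + E]]; move: E; rewrite fE.
  case: i xi => xi /= E.
    case/memv_addP => _ /vlineP [k ->] [_ /vlineP [l ->]].
    rewrite odd_extension_span => wE; move: E; rewrite wE.
    by rewrite [RHS]vecD addr0 => -[_ -> _].
  rewrite memv0 => /eqP w0; move: E; rewrite w0 addr0.
  by case=> -> -> ->; rewrite eqxx.
move=> [ui rt]; exists (vec 0 u 0); first by rewrite -fE memv_img.
exists (vec r 0 t); last by rewrite vecD !add0r addr0.
case: i ui rt => [_ _|_ /andP [/eqP -> /eqP ->]]; last exact: mem0v.
apply/memv_addP; exists (r *: ext_x a); first by apply/vlineP; exists r.
exists (t *: ext_xs a); first by apply/vlineP; exists t.
by rewrite odd_extension_span.
Qed.

(** [D] is odd while [B] is even; this is why the [x]-component of a bracket of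
two elements of the same parity vanishes. *)
Lemma form_D_same_parity i u v :
  u \in sd_part a i -> v \in sd_part a i -> B (D u) v = 0.
Proof.
move=> ui vi; apply: (Bev (D_der.2 _ _ ui) vi).
by case: (i).
Qed.

(** Since [D] is self-adjoint with [D^2 = ad a0], the value is
[B u [a0, u] = B [u, u] a0]. Symmetry of [B] alone gives nothing here, because
[D u] is even and [B] need not be alternating on even vectors. *)
Lemma form_D_self u : u \in odd_part a -> B (D u) (D u) = 0.
Proof.
move=> uo; rewrite D_B D_square brC -Binv (sd_br_odd_self charK aL uo).
by rewrite Bsym (bilinear_for0r (nis_bilinear (enis_NIS aN))).
Qed.

Let part_ext i r u t :
  u \in sd_part a i -> (i || (r == 0) && (t == 0)) -> vec r u t \in sd_part g i.
Proof. by rewrite mem_odd_extension => -> ->. Qed.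

(** The Jacobi identities of [g] split into those of [a], the derivation rules
for [D], and pairings of these with [B]; the terms in [t ^+ 2] are where
[D^2 = ad a0] enters. *)
Lemma odd_extension_lie : is_lie_superalgebra2 g.
Proof.
split.
- split.
    apply/vspaceP => z; rewrite memvf; have [r [u [t ->]]] := odd_extension_vecP z.
    have [x xe [y yo ->]] := superspace_decomp aL u.
    apply/memv_addP; exists (vec 0 x 0); first by rewrite part_ext ?eqxx.
    exists (vec r y t); first by rewrite part_ext.
    by rewrite vecD !add0r.
  apply/vspaceP => z; have [r [u [t ->]]] := odd_extension_vecP z.
  rewrite memv_cap memv0; apply/andP/eqP => [|->]; last by rewrite !mem0v.
  rewrite !mem_odd_extension /=.
  case=> /and3P [ue /eqP -> /eqP ->] /andP [uo _].
  suff -> : u = 0 by [].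
  by apply/eqP; rewrite -memv0 -(lsa_superspace aL).2 memv_cap ue uo.
- split=> w c z1 z2;
    [rewrite -[RHS]/(c *: sd_br z1 w + sd_br z2 w) |
     rewrite -[RHS]/(c *: sd_br w z1 + sd_br w z2)];
    have [r [u [t ->]]] := odd_extension_vecP w;
    have [r1 [u1 [t1 ->]]] := odd_extension_vecP z1;
    have [r2 [u2 [t2 ->]]] := odd_extension_vecP z2;
    rewrite vecZ vecD !brE vecZ vecD; congr vec; rewrite ?mulr0 ?addr0 //.
  + by rewrite DD DZ BDl BZl.
  + rewrite brDl brZl DD DZ !(scalerDl, scalerDr) !scalerA (mulrC t c).
    by rewrite [LHS](AC (2*2*2) ((1*3*5)*(2*4*6))).
  + by rewrite BDr BZr.
  + rewrite brDr brZr DD DZ !(scalerDl, scalerDr) !scalerA (mulrC t c).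
    by rewrite [LHS](AC (2*2*2) ((1*3*5)*(2*4*6))).
- move=> i j z w; have [r [u [t ->]]] := odd_extension_vecP z.
  have [r' [v [t' ->]]] := odd_extension_vecP w.
  rewrite brE !mem_odd_extension eqxx andbT => /andP [ui ti] /andP [vj tj].
  apply/andP; split.
    rewrite !rpredD ?(lsa_graded aL ui vj) //.
      case: i ti {ui} => [_|/andP [_ /eqP ->]]; last by rewrite scale0r mem0v.
      by rewrite rpredZ ?(D_der.2 _ _ vj).
    case: j tj {vj} => [_|/andP [_ /eqP ->]]; last by rewrite scale0r mem0v.
    by rewrite rpredZ // addbC (D_der.2 _ _ ui).
  case: (boolP (i (+) j)) => //=; rewrite negb_add => /eqP ij.
  by apply/eqP; apply: (@form_D_same_parity i); rewrite // ij.
- move=> z; have [r [u [t ->]]] := odd_extension_vecP z.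
  rewrite mem_odd_extension => /and3P [ue /eqP -> /eqP ->].
  by rewrite brE (form_D_same_parity ue ue) (lsa_alternating aL ue)
    !scale0r !addr0.
- move=> x y z; have [r [u [t ->]]] := odd_extension_vecP x.
  have [r' [v [t' ->]]] := odd_extension_vecP y.
  have [q [w [s ->]]] := odd_extension_vecP z.
  rewrite !mem_odd_extension => /and3P [ue /eqP -> /eqP ->].
  move=> /and3P [ve /eqP -> /eqP ->].
  rewrite !brE !scale0r !addr0 -scaleN1r vecZ vecD scaleN1r; congr vec.
  + rewrite D_br BDl !BDr !BZr Binv [sd_br u (D v)]brC Binv [B (D v) (D u)]Bsym.
    by rewrite mulN1r oppr_pchar2 // addrACA addrr_pchar2 // addr0.
  + rewrite (lsa_jacobi aL w ue ve) D_br !brDr !brZr Nv scalerDr [sd_br (D u) v]brC.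
    by rewrite Nv [RHS]addrACA [s *: _ + s *: _]addrC.
  + by rewrite mulr0 addr0.
- move=> x y; have [r [u [t ->]]] := odd_extension_vecP x.
  have [r' [v [t' ->]]] := odd_extension_vecP y.
  by rewrite !brE D_B Bsym [sd_br v u]brC addrAC.
- move=> x; have [r [u [t ->]]] := odd_extension_vecP x.
  rewrite sqE !mem_odd_extension => /andP [uo _].
  by rewrite !eqxx andbT !rpredD ?rpredZ ?(lsa_sq_even aL uo) //
    (D_der.2 _ _ uo).
- move=> c x; have [r [u [t ->]]] := odd_extension_vecP x.
  rewrite mem_odd_extension => /andP [uo _].
  rewrite [c *: vec _ _ _]vecZ !sqE vecZ !mulr0 (lsa_sq_scale aL _ uo).
  by rewrite DZ exprMn !scalerDr !scalerA [c * t * c]mulrAC.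
- move=> x y; have [r [u [t ->]]] := odd_extension_vecP x.
  have [r' [v [t' ->]]] := odd_extension_vecP y.
  rewrite !mem_odd_extension => /andP [uo _] /andP [vo _].
  rewrite vecD brE !sqE -2!scaleN1r !vecZ !vecD !scaleN1r !mulr0 !addr0.
  congr vec; first exact: form_D_same_parity uo vo.
  rewrite !Nv (lsa_polarization aL uo vo) !Nv.
  (* The square is additive, so a0 does not contribute to the bracket. *)
  have -> : (t + t') ^+ 2 = t ^+ 2 + t' ^+ 2.
    by rewrite sqrrD mulrn_pchar // addr0.
  rewrite DD !scalerDl !scalerDr [RHS](AC (1*2*(2*2)*3*3)
    ((1*8*11*5*6)*((2*9)*(3*12)*(4*10)*(7*13)))) /=.
  by rewrite !vv !addr0.
- move=> x y; have [r [u [t ->]]] := odd_extension_vecP x.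
  have [r' [v [t' ->]]] := odd_extension_vecP y.
  rewrite sqE !brE mem_odd_extension => /andP [uo _]; congr vec.
    rewrite !DD !DZ D_a0 scaler0 addr0 (D_sq uo) !BDl BZl Binv !BDr !BZr.
    by rewrite (form_D_self uo) mulr0 addr0 [B (D (D u)) v]D_B.
  rewrite !scale0r !addr0 !brDl !brZl (lsa_sq_jacobi aL v uo) !DD !DZ D_a0.
  rewrite scaler0 addr0 (D_sq uo) D_br !brDr !brZr !D_square !scalerDr !scalerA.
  rewrite [sd_br (D u) u]brC [t' * t]mulrC -expr2.
  rewrite [RHS](AC (3*(2*1*1)) ((1*6*4)*(3*7)*(2*5))) /=.
  by rewrite vv addr0.
Qed.

Lemma odd_extension_NIS : is_even_NIS_lie_superalgebra2 Bg.
Proof.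
split; first exact: odd_extension_lie.
  split.
  - split=> w c z1 z2;
    [rewrite -[RHS]/(c * Bg z1 w + Bg z2 w) |
     rewrite -[RHS]/(c * Bg w z1 + Bg w z2)];
    have [r [u [t ->]]] := odd_extension_vecP w;
    have [r1 [u1 [t1 ->]]] := odd_extension_vecP z1;
    have [r2 [u2 [t2 ->]]] := odd_extension_vecP z2;
    rewrite vecZ vecD !formE.
    + by rewrite BDl BZl; ring.
    + by rewrite BDr BZr; ring.
  - move=> x y; have [r [u [t ->]]] := odd_extension_vecP x.
    have [r' [v [t' ->]]] := odd_extension_vecP y.
    by rewrite !formE Bsym; ring.
  - move=> x; have [r [u [t ->]]] := odd_extension_vecP x.
    rewrite mem_odd_extension formE => /andP [uo _].
    rewrite (nis_odd_null (enis_NIS aN) uo) add0r [t * r]mulrC.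
    exact: addrr_pchar2.
  - move=> x y z; have [r [u [t ->]]] := odd_extension_vecP x.
    have [r' [v [t' ->]]] := odd_extension_vecP y.
    have [q [w [s ->]]] := odd_extension_vecP z.
    by rewrite !brE !formE !BDl !BDr !BZl !BZr Binv !D_B; ring.
  - move=> x; have [r [u [t ->]]] := odd_extension_vecP x => xP.
    (* Pairing with x^* and x reads off the coordinates along x and x^*. *)
    have /eqP := xP (vec 0 0 1); have /eqP := xP (vec 1 0 0).
    have B0 := bilinear_for0r (nis_bilinear (enis_NIS aN)).
    rewrite !formE !B0 !mulr0 !mulr1 !addr0 !add0r => /eqP -> /eqP ->.
    rewrite (nis_nondegenerate (enis_NIS aN) (x := u)) // => v.
    by have := xP (vec 0 v 0); rewrite formE !mulr0 !addr0.
move=> i j x y; have [r [u [t ->]]] := odd_extension_vecP x.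
have [r' [v [t' ->]]] := odd_extension_vecP y.
rewrite formE !mem_odd_extension => /andP [ui ti] /andP [vj tj] ij.
rewrite (Bev ui vj ij) add0r; case: i j ij ti tj {ui vj} => [] [] //= _.
  by move=> _ /andP [/eqP -> /eqP ->]; rewrite !mulr0 addr0.
by move=> /andP [/eqP -> /eqP ->] _; rewrite !mul0r addr0.
Qed.

(** * Extending an even derivation *)

Variables (Dt : a -> a) (Dt_der : in_der false Dt) (Dt_bij : bijective Dt).
Hypothesis Dt_B : forall u v : a, B (Dt u) v = B u (Dt v).
Hypothesis Dt_B0 : forall u : a, u \in even_part a -> B (Dt u) u = 0.
Variables (lam : K) (lam_neq0 : lam != 0) (b0 : a) (b0_odd : b0 \in odd_part a).
Hypothesis Dt_D : forall u : a, Dt (D u) + D (Dt u) = lam *: D u + sd_br b0 u.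
Hypothesis Dt_a0 : Dt a0 = D b0.
Variable mu : K.

Let Delta : g -> g := ext_Delta Dt lam mu b0.

Let Dt_linear : linear Dt. Proof. by case: Dt_der => -[]. Qed.
Let DtL : {linear a -> a} :=
  HB.pack Dt (GRing.isLinear.Build K a a _ Dt Dt_linear).
Let DtD u v : Dt (u + v) = Dt u + Dt v := linearD DtL u v.
Let DtZ c u : Dt (c *: u) = c *: Dt u := linearZ_LR DtL c u.
Let Dt_br u v : Dt (sd_br u v) = sd_br (Dt u) v + sd_br u (Dt v) :=
  derivation_br charK aL u v Dt_der.1.

Let Dt_sq u : u \in odd_part a -> Dt (sd_sq u) = sd_br (Dt u) u.
Proof. by case: Dt_der => -[_ _ +] _; apply. Qed.

Lemma ext_DeltaE r u t : Delta (vec r u t) =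
  vec (lam * r + B u b0 + mu * t) (Dt u + t *: b0) (lam * t).
Proof.
rewrite -[LHS]/(vec
  (r * (lam * 1) + (0 + B u b0 * 1) + t * (lam * 0 + 0 + mu * 1))
  (r *: (lam *: 0) + (Dt u + B u b0 *: 0) + t *: (lam *: 0 + b0 + mu *: 0))
  (r * (lam * 0) + (0 + B u b0 * 0) + t * (lam * 1 + 0 + mu * 0))).
congr vec; [by ring | | by ring].
by rewrite !(scaler0, addr0, add0r).
Qed.

Let DtDE u : Dt (D u) = D (Dt u) + lam *: D u + sd_br b0 u.
Proof. by rewrite -addrA -Dt_D addrCA vv addr0. Qed.

Let B_odd_b0 u : u \in even_part a -> B u b0 = 0.
Proof. by move=> ue; exact: (Bev ue b0_odd). Qed.

(** The summand [B u b0] of the [x]-component is the adjoint of the summand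
[t *: b0] of the [a]-component, which makes the map self-adjoint. *)
Lemma ext_Delta_form_invariant : form_invariant_under Bg Delta.
Proof.
split=> [x y | x].
  have [r [u [t ->]]] := odd_extension_vecP x.
  have [r' [v [t' ->]]] := odd_extension_vecP y.
  by rewrite !ext_DeltaE !formE BDl BDr BZl BZr Dt_B [B b0 v]Bsym; ring.
have [r [u [t ->]]] := odd_extension_vecP x.
rewrite ext_DeltaE mem_odd_extension formE => /and3P [ue /eqP -> /eqP ->].
by rewrite scale0r addr0 !mulr0 !addr0 Dt_B0.
Qed.

(** The map is triangular for [x], [a], [x^*] with diagonal [lam], [Dt], [lam];
its inverse is found by back substitution, starting from the coordinate along
[x^*]. *)
Lemma ext_Delta_bijective : bijective Delta.
Proof.
have [Dti DtK DtiK] := Dt_bij.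
pose inv (z : g) : g := let: (r, u, t) := z in
  let t' := lam^-1 * t in let u' := Dti (u - t' *: b0) in
  vec (lam^-1 * (r - B u' b0 - mu * t')) u' t'.
have invE r u t : inv (vec r u t) =
  vec (lam^-1 * (r - B (Dti (u - (lam^-1 * t) *: b0)) b0 - mu * (lam^-1 * t)))
    (Dti (u - (lam^-1 * t) *: b0)) (lam^-1 * t) by [].
exists inv => z; have [r [u [t ->]]] := odd_extension_vecP z.
  rewrite ext_DeltaE invE mulKf // addrK DtK; congr vec.
  by rewrite (_ : _ - _ = lam * r) ?mulKf //; ring.
rewrite invE ext_DeltaE DtiK subrK !mulVKf //; congr vec; ring.
Qed.

Lemma ext_Delta_parity : has_parity false Delta.
Proof.
move=> i x; have [r [u [t ->]]] := odd_extension_vecP x.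
rewrite ext_DeltaE !mem_odd_extension => /andP [ui ti].
rewrite /= rpredD ?(Dt_der.2 _ _ ui) //=; last first.
  case: i ti {ui} => [_|/andP [_ /eqP ->]]; last by rewrite scale0r mem0v.
  by rewrite rpredZ.
case: i ui ti => //= ue /andP [/eqP -> /eqP ->].
by rewrite B_odd_b0 // !mulr0 !addr0 eqxx.
Qed.

(** The commutation rule of [Dt] and [D] gives the Leibniz rule against [x^*]
in the [a]-component, and in the [x]-component after pairing with [B]. On
squares the new contribution is [t ^+ 2 *: a0], matched by [Dt a0 = D b0]. *)
Lemma ext_Delta_derivation : is_derivation Delta.
Proof.
split.
- move=> c z1 z2; rewrite -[RHS]/(c *: Delta z1 + Delta z2).
  have [r1 [u1 [t1 ->]]] := odd_extension_vecP z1.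
  have [r2 [u2 [t2 ->]]] := odd_extension_vecP z2.
  rewrite vecZ vecD !ext_DeltaE vecZ vecD; congr vec; last by ring.
    by rewrite BDl BZl; ring.
  by rewrite DtD DtZ scalerDl scalerDr scalerA addrACA.
- move=> x y; have [r [u [t ->]]] := odd_extension_vecP x.
  have [r' [v [t' ->]]] := odd_extension_vecP y.
  rewrite mem_odd_extension => /and3P [ue /eqP -> /eqP ->].
  rewrite brE !ext_DeltaE !brE vecD !mulr0 !scale0r !addr0; congr vec.
    rewrite BDl BDr BZl BZr -[B (D u) (Dt v)]Dt_B DtDE !BDl BZl.
    (* Two copies of B (D (Dt u)) v cancel. *)
    rewrite [B (sd_br u v) b0]Bsym -Binv.
    by rewrite !addrA addrr_pchar2 // add0r.
  rewrite DtD DtZ Dt_br DtDE brDr brZr [sd_br u b0]brC !scalerDr !scalerA.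
  by rewrite [lam * t']mulrC [LHS](AC (2*3) ((1*3)*(2*5*4))).
- move=> x; have [r [u [t ->]]] := odd_extension_vecP x.
  rewrite sqE !ext_DeltaE brE mem_odd_extension => /andP [uo _].
  have s_even : sd_sq u + t ^+ 2 *: a0 + t *: D u \in even_part a.
    by rewrite !rpredD ?rpredZ ?(lsa_sq_even aL uo) // (D_der.2 _ _ uo).
  have v_odd : Dt u + t *: b0 \in odd_part a.
    by rewrite rpredD ?rpredZ // (Dt_der.2 _ _ uo).
  rewrite (form_D_same_parity v_odd uo) B_odd_b0 // !mulr0 !addr0 scale0r addr0.
  congr vec; rewrite !DtD !DtZ Dt_sq // Dt_a0 DtDE brDl brZl DD DZ.
  rewrite !scalerDr !scalerA -expr2 [lam * t]mulrC.
  by rewrite [LHS](AC (2*3) ((1*5*4)*(3*2))).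
Qed.

End OddExtension.

Theorem theorem4p1p9 (K : fieldType) (charK : 2%N \in [pchar K])
  (a : superdata K) (Ba wa : a -> a -> K)
  (a_NIS : is_even_NIS_lie_superalgebra2 Ba)
  (wa_form : is_closed_antisym_ortho_form wa)
  (Dt : a -> a) (Dt_der : in_der false Dt) (Dt_inv : bijective Dt)
  (wa_Dt : forall u v : a, wa u v = Ba (Dt u) v)
  (D : a -> a) (D_der : in_der true D)
  (a0 : a) (a0_even : a0 \in even_part a)
  (D_Ba : forall u v : a, Ba (D u) v = Ba u (D v))
  (D_square : forall u : a, D (D u) = sd_br a0 u)
  (D_a0 : D a0 = 0)
  (lam : K) (lam_neq0 : lam != 0)
  (b0 : a) (b0_odd : b0 \in odd_part a)
  (Dt_D : forall u : a, Dt (D u) + D (Dt u) = lam *: D u + sd_br b0 u)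
  (Dt_a0 : Dt a0 = D b0)
  (mu : K) :
  let g := odd_extension Ba D a0 in
  let Bg : g -> g -> K := ext_form (B := Ba) (D := D) (a0 := a0) in
  let Delta : g -> g := ext_Delta Dt lam mu b0 in
  let wg : g -> g -> K := fun u v => Bg (Delta u) v in
  [/\ is_derivation Delta,
      bijective Delta,
      form_invariant_under Bg Delta,
      is_even_NIS_lie_superalgebra2 Bg &
      is_closed_antisym_ortho_form wg].
Proof.
move=> g Bg Delta wg.
have [wa_sym wa_even] := cao_antisymmetric wa_form.
have Ba_sym := nis_symmetric (enis_NIS a_NIS).
have Dt_Ba u v : Ba (Dt u) v = Ba u (Dt v).
  by rewrite -wa_Dt wa_sym wa_Dt Ba_sym.
have Dt_Ba0 u : u \in even_part a -> Ba (Dt u) u = 0.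
  by move=> ue; rewrite -wa_Dt wa_even.
have gN : is_even_NIS_lie_superalgebra2 Bg by exact: odd_extension_NIS.
have Delta_der : is_derivation Delta by exact: ext_Delta_derivation.
have Delta_bij : bijective Delta by exact: ext_Delta_bijective.
have Delta_inv : form_invariant_under Bg Delta.
  exact: ext_Delta_form_invariant.
split=> //; apply: (derived_form_closed_antisym_ortho charK (enis_lie gN)).
- exact: enis_NIS gN.
- exact: enis_even gN.
- by split=> //; apply: ext_Delta_parity.
- exact: bij_inj.
- exact: Delta_inv.
Qed.
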